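(* Let $H$ be a limit circle Hamburger Hamiltonian with lengths $(l_j)_{j=1}^\infty$ and angles $(\phi_j)_{j=1}^\infty$. Assume $\alpha\ge1$ and $\beta\in(0,1)$ are such that $$(l_j)_{j=1}^\infty\in\ell^{\frac1\alpha},\qquad\big(|\sin(\phi_{j+1}-\phi_j)|\big)_{j=1}^\infty\in\ell^{\frac1\beta}.$$ Fix $\psi\in\mathbb{R}$ and consider the increasing function $F\colon\mathbb{N}\to(0,\infty)$, $$F(N):=N^{\frac{1-\beta}{\alpha}}\Big[\Big(\sum_{j=N+1}^\infty l_j\Big)\Big(\sum_{j=N+1}^\infty l_j\sin^2(\phi_j-\psi)\Big)\Big]^{-\frac{\alpha+1}{2\alpha}}.$$ Then there is a constant $C>0$ such that $$\log|w_{H,22}(ir)|\ \le\ C\big(r\,F^-(r)^{1-\beta}\big)^{\frac1{\alpha+1}}$$ for all sufficiently large $r$, where $F^-(r):=\max\{N\in\mathbb{N} : F(N)<r\}$.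
   Context: Limit circle Hamburger Hamiltonian: let $(l_j)_{j=1}^\infty$ be positive numbers (''lengths'') with $L:=\sum_{j=1}^\infty l_j<\infty$, and $(\phi_j)_{j=1}^\infty$ real numbers (''angles'') with $\phi_{j+1}-\phi_j\notin\pi\mathbb{Z}$ for all $j$. Put $x_0:=0$, $x_n:=\sum_{j=1}^n l_j$, $\xi_\phi:=(\cos\phi,\sin\phi)^\top$, and $H(t):=\xi_{\phi_j}\xi_{\phi_j}^\top$ for $x_{j-1}\le t<x_j$, $j\in\mathbb{N}$; this defines $H$ on $(0,L)$. Monodromy matrix: with $J=\begin{pmatrix}0&-1\\1&0\end{pmatrix}$, for $z\in\mathbb{C}$ let $W_H(t;z)$ be the solution of $\frac{d}{dt}W_H(t;z)J=zW_H(t;z)H(t)$ for a.e. $t\in(0,L)$, $W_H(0;z)=I$. It exists up to $t=L$, and $W_H(z):=W_H(L;z)=(w_{H,ij}(z))_{i,j=1}^2$. For $p>0$, $(u_j)\in\ell^p$ means $\sum_j|u_j|^p<\infty$. Here $\mathbb{N}=\{1,2,\dots\}$. *)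

(* Defs.v *)
From HB Require Import structures.
From mathcomp Require Import all_boot all_order all_algebra.
From mathcomp Require Import all_classical all_reals all_analysis.
From mathcomp Require Export complex.
Set Implicit Arguments.
Unset Strict Implicit.
Unset Printing Implicit Defensive.
Import Order.TTheory GRing.Theory Num.Theory.
Import numFieldNormedType.Exports.
Local Open Scope classical_set_scope.
Local Open Scope ring_scope.

(* A sequence (u_j) with j >= 1 is a function nat -> R; its value at 0 is
   ignored everywhere. *)

Definition in_ell (R : realType) (p : R) (u : nat -> R) : Prop :=
  (\sum_(1 <= j <oo) (`|u j| `^ p)%:E < +oo)%E.

Definition tail_sum (R : realType) (u : nat -> R) (N : nat) : R :=
  \big[+%R/0]_(N.+1 <= j <oo) u j.

Definition total_length (R : realType) (l : nat -> R) : R := tail_sum l 0.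

Definition node (R : realType) (l : nat -> R) (n : nat) : R :=
  \sum_(1 <= j < n.+1) l j.

Definition xi (R : realType) (a : R) : 'cV[R]_2 :=
  \col_(i < 2) (if i == ord0 then cos a else sin a).

Definition limit_circle_Hamburger (R : realType) (l phi : nat -> R)
    (H : R -> 'M[R]_2) : Prop :=
  [/\ forall j, (1 <= j)%N -> 0 < l j,
      (\sum_(1 <= j <oo) (l j)%:E < +oo)%E,
      forall j, (1 <= j)%N -> forall m : int,
        phi j.+1 - phi j != pi * m%:~R
    & forall j t, (1 <= j)%N -> node l j.-1 <= t < node l j ->
        H t = xi (phi j) *m (xi (phi j))^T].

(* J = ((0, -1), (1, 0)) *)
Definition Jmx (K : pzRingType) : 'M[K]_2 :=
  \matrix_(i < 2, j < 2) ((j < i)%N%:R - (i < j)%N%:R).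

(* The library has no normed-module structure over R on R[i], hence the
   derivative of a complex function of a real variable is taken separately on
   its real and imaginary parts. *)
Definition is_derive_mx (R : realType) (W : R -> 'M[R[i]]_2) (t : R)
    (D : 'M[R[i]]_2) : Prop :=
  forall i j,
    is_derive t (1 : R) (fun s => complex.Re (W s i j)) (complex.Re (D i j)) /\
    is_derive t (1 : R) (fun s => complex.Im (W s i j)) (complex.Im (D i j)).

Definition absolutely_continuous_on (R : realType) (a b : R) (f : R -> R[i]) :
    Prop :=
  forall e : R, 0 < e -> exists2 d : R, 0 < d &
    forall (n : nat) (u v : 'I_n -> R),
      (forall k, [/\ a <= u k, u k <= v k & v k <= b]) ->
      trivIset [set: 'I_n] (fun k => `]u k, v k[%classic) ->
      \sum_(k < n) (v k - u k) < d ->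
      \sum_(k < n) ComplexField.Normc.normc (f (v k) - f (u k)) < e.

(* Solution on [0, L], in the sense of Caratheodory, of W' J = z W H a.e. on
   (0, L), W(0) = I. *)
Definition fundamental_solution (R : realType) (H : R -> 'M[R]_2) (L : R)
    (z : R[i]) (W : R -> 'M[R[i]]_2) : Prop :=
  [/\ forall i j, absolutely_continuous_on 0 L (fun t => W t i j),
      W 0 = 1%:M
    & {ae lebesgue_measure, forall t : R, 0 < t < L ->
        exists2 D : 'M[R[i]]_2, is_derive_mx W t D &
          D *m Jmx _ = z *: (W t *m map_mx (real_complex R) (H t))}].

Definition growthF (R : realType) (l phi : nat -> R) (alpha beta psi : R)
    (N : nat) : R :=
  N%:R `^ ((1 - beta) / alpha) *
  (tail_sum l N * tail_sum (fun j => l j * sin (phi j - psi) ^+ 2) N)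
    `^ (- ((alpha + 1) / (2 * alpha))).

(* max {N >= 1 | F N < r}; the value is 0 if there is no maximum. *)
Definition Fminus (R : realType) (F : nat -> R) (r : R) : nat :=
  let A := [set N : nat | (1 <= N)%N /\ F N < r] in
  xget 0%N (A `&` ubound A).

(* Main.v *)
Require Import Defs.
From mathcomp Require Import all_boot all_order all_algebra.
From mathcomp Require Import all_classical all_reals all_analysis.
From mathcomp Require Import measurable_realfun ring lra.
Import Order.TTheory GRing.Theory Num.Theory.
Import numFieldNormedType.Exports.
Local Open Scope classical_set_scope.
Local Open Scope ring_scope.

(** Only the second row of [W t (ir)] matters; it is followed through the real
    plane vectors [x] and [y] of the real and imaginary parts of its entries.
    On the [j]-th interval the equation leaves the component of the row along
    [xi (phi j)] unchanged and moves the orthogonal one at a constant rate, so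
    the values at the nodes satisfy an explicit recursion ([row2_recursion]).
    As solutions are only absolutely continuous and differentiable almost
    everywhere, this rests on the fact that an absolutely continuous function
    whose derivative vanishes almost everywhere is constant
    ([abs_cont_derive0]).

    Write [F] for the growth function, [n] for the successor of [Fminus F r],
    so that [r <= F n], and [G = (r n^(1 - beta))^(1 / (alpha + 1))], called
    [rate] below.  The row is estimated separately on the first [n] intervals
    and on the remaining ones.

    - First [n] intervals ([norm1_head]).  In the frame turning with the angles
      [phi j], take the norm [|p| + e |q|], where [p] is the component along
      [xi (phi j)], [q] the orthogonal one, and [e <= 1].  An interval
      multiplies it by at most [1 + e r l_j], a turn of the frame by at most
      [1 + |sin (phi_(j+1) - phi_j)| / e].  Up to constants, the two
      summability hypotheses bound the logarithm of the product by
      [(e r)^(1 / alpha) + n^(1 - beta) / e], and one choice of [e] makes both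
      terms equal to [G].  If this [e] is larger than [1], then
      [r^(1 / alpha) <= G], and the Euclidean norm, which turning the frame
      preserves, suffices.

    - Remaining intervals ([wnorm_tail]).  In the frame of fixed angle [psi],
      with the norm [b |p| + |q|] and [b >= 1], an interval costs at most the
      factor [1 + 2 r l_j (b sin^2 (phi_j - psi) + 1 / b)].  With [T] and [S]
      the tails of [l_j] and [l_j sin^2 (phi_j - psi)], the product is at most
      [exp (2 r (b S + T / b))].  The inequality [r <= F n] means precisely
      that [T S <= (G / r)^2] ([le_growthF]), hence the exponent is at most
      [4 G] for [b = max 1 (T r / G)].

    Comparing the norms costs the factors [1 / e] and [b], which are at most
    exponentials of multiples of [G].  Finally [G] for [n = N + 1] is at most
    twice [G] for [N] ([rateS]). *)

(** * Absolutely continuous functions with zero derivative *)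

(** Absolute continuity of a real-valued function on the closed interval from
    [a] to [b]. *)
Definition abs_cont {R : realType} (a b : R) (f : R -> R) : Prop :=
  forall e : R, 0 < e -> exists2 d : R, 0 < d &
    forall (n : nat) (u v : 'I_n -> R),
      (forall k, [/\ a <= u k, u k <= v k & v k <= b]) ->
      trivIset [set: 'I_n] (fun k => `]u k, v k[%classic) ->
      \sum_(k < n) (v k - u k) < d ->
      \sum_(k < n) `|f (v k) - f (u k)| < e.

Lemma abs_contS (R : realType) (a b a' b' : R) (f : R -> R) :
  a <= a' -> b' <= b -> abs_cont a b f -> abs_cont a' b' f.
Proof.
move=> aa bb acf e e0; have [d d0 H] := acf e e0; exists d => // n u v uv.
apply: H => k; have [h1 h2 h3] := uv k.
by split=> //; [exact: le_trans h1|exact: le_trans bb].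
Qed.

Lemma abs_cont_id (R : realType) (a b : R) : abs_cont a b id.
Proof.
move=> e e0; exists e => // n u v uv _ H; apply: le_lt_trans H.
by apply: ler_sum => k _; have [_ h _] := uv k; rewrite ger0_norm ?subr_ge0.
Qed.

Lemma abs_contZ (R : realType) (a b c : R) (f : R -> R) :
  abs_cont a b f -> abs_cont a b (fun t => c * f t).
Proof.
move=> acf e e0.
have c1 : 0 < `|c| + 1 by rewrite ltr_wpDl.
have [d d0 H] := acf (e / (`|c| + 1)) (divr_gt0 e0 c1).
exists d => // n u v uv tI sd; have {H} := H n u v uv tI sd.
rewrite ltr_pdivlMr// => H; apply: le_lt_trans H.
rewrite mulr_suml; apply: ler_sum => k _.
by rewrite -mulrBr normrM mulrC ler_wpM2l// lerDl.
Qed.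

Lemma abs_contD (R : realType) (a b : R) (f g : R -> R) :
  abs_cont a b f -> abs_cont a b g -> abs_cont a b (fun t => f t + g t).
Proof.
move=> acf acg e e0; have e20 : 0 < e / 2 by rewrite divr_gt0.
have [d d0 Hf] := acf _ e20; have [d' d'0 Hg] := acg _ e20.
exists (Num.min d d'); first by rewrite lt_min d0.
move=> n u v uv tI; rewrite lt_min => /andP[sd sd'].
have := ltrD (Hf n u v uv tI sd) (Hg n u v uv tI sd').
rewrite -splitr => H; apply: le_lt_trans H; rewrite -big_split/=.
by apply: ler_sum => k _; rewrite opprD addrACA ler_normD.
Qed.

Section zero_derivative.
Context {R : realType}.
Implicit Types (a b e s x y : R) (f : R -> R) (U : set R).

(** From [a] to [x], the function [f] moves by at most [e * (x - a)], up to its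
    variation over finitely many disjoint open intervals contained in [U]. *)
Definition small_outside U f e a x : Prop :=
  exists (n : nat) (u v : 'I_n -> R),
    [/\ forall k, [/\ a <= u k, u k <= v k & v k <= x],
        trivIset [set: 'I_n] (fun k => `]u k, v k[%classic),
        forall k, `]u k, v k[ `<=` U
      & `|f x - f a| <= e * (x - a) + \sum_(k < n) `|f (v k) - f (u k)|].

Lemma small_outside_refl U f e a : small_outside U f e a a.
Proof.
exists 0%N, (fun=> 0), (fun=> 0); split=> [[]//|[]//|[]//|].
by rewrite !subrr normr0 mulr0 big_ord0 addr0.
Qed.

Lemma small_outside_slope U f e a s y : s <= y ->
  small_outside U f e a s -> `|f y - f s| <= e * (y - s) ->
  small_outside U f e a y.
Proof.
move=> sy [n [u [v [uv tI uvU fs]]]] fys; exists n, u, v; split=> //.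
  by move=> k; have [h1 h2 h3] := uv k; split=> //; exact: le_trans sy.
have -> : f y - f a = (f y - f s) + (f s - f a) by ring.
apply: le_trans (ler_normD _ _) _; lra.
Qed.

Lemma small_outside_itv U f e a s y : 0 <= e -> a <= s -> s <= y ->
  small_outside U f e a s -> `]s, y[ `<=` U -> small_outside U f e a y.
Proof.
move=> e0 as_ sy [n [u [v [uv tI uvU fs]]]] syU.
(* prepends an interval to the family *)
pose ext (w : 'I_n -> R) z (k : 'I_n.+1) : R := oapp w z (unlift ord0 k).
have ext0 w z : ext w z ord0 = z by rewrite /ext unlift_none.
have extS w z k : ext w z (lift ord0 k) = w k by rewrite /ext liftK.
exists n.+1, (ext u s), (ext v y); split.
- move=> k; case: (unliftP ord0 k) => [j|] ->; rewrite ?ext0 ?extS//.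
  by have [h1 h2 h3] := uv j; split=> //; exact: le_trans sy.
- have disj j t : `]u j, v j[%classic t -> `]s, y[%classic t -> False.
    rewrite /= !in_itv/= => /andP[_ h] /andP[h' _].
    by have [_ _ h3] := uv j; move: (lt_trans h' h); rewrite ltNge h3.
  move=> i j _ _.
  case: (unliftP ord0 i) => [i'|] ->; case: (unliftP ord0 j) => [j'|] ->;
    rewrite ?ext0 ?extS//.
  + by move=> h; rewrite (tI i' j').
  + by case=> t [/disj h /h].
  + by case=> t [+ /disj h] => /h.
- by move=> k; case: (unliftP ord0 k) => [j|] ->; rewrite ?ext0 ?extS.
- rewrite big_ord_recl !ext0; under eq_bigr do rewrite !extS.
  have -> : f y - f a = (f y - f s) + (f s - f a) by ring.
  apply: le_trans (ler_normD _ _) _.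
  have : 0 <= e * (y - s) by rewrite mulr_ge0 ?subr_ge0.
  lra.
Qed.

(** A version of Cousin's lemma: the set of the [x] reached from [a] by steps
    of either kind has a supremum, which is reached and cannot be below [b]. *)
Lemma small_outside_total U f e a b : 0 <= e -> a <= b ->
  (forall x, a <= x <= b -> exists2 h, 0 < h & forall s y,
    a <= s -> s <= x -> x <= y -> y <= b -> x - h < s -> y < x + h ->
    `]s, y[ `<=` U \/ `|f y - f s| <= e * (y - s)) ->
  small_outside U f e a b.
Proof.
move=> e0 ab loc.
pose S := [set x | a <= x <= b /\ small_outside U f e a x].
have Sa : S a by split; [rewrite lexx|exact: small_outside_refl].
have hS : has_sup S.
  by split; [exists a|exists b => x [/andP[]]].
pose c := sup S.
have ac_ : a <= c by apply: ub_le_sup => //; case: hS.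
have cb : c <= b by apply: ge_sup; [exists a|move=> x [/andP[]]].
have [h h0 hc] := loc c (introT andP (conj ac_ cb)).
have [s [/andP[as_ sb] Ss] cs] := sup_adherent h0 hS.
have sc : s <= c by apply: ub_le_sup; [case: hS|split=> //; rewrite as_].
have step y : c <= y -> y <= b -> y < c + h -> small_outside U f e a y.
  move=> cy yb yh; have sy := le_trans sc cy.
  by case: (hc s y) => //; [exact: small_outside_itv|exact: small_outside_slope].
have [cltb|bc] := ltP c b; last first.
  apply: step => //; apply: le_lt_trans bc _; rewrite ltrDl//.
pose y := Num.min b (c + h / 2).
have cy : c < y by rewrite lt_min cltb ltrDl divr_gt0.
have yb : y <= b by rewrite ge_min lexx.
have : S y.
  split; first by rewrite (le_trans ac_ (ltW cy)).
  apply: step => //; first exact: ltW.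
  by rewrite gt_min; apply/orP; right; lra.
by move=> /(ub_le_sup hS.2); rewrite leNgt cy.
Qed.

Lemma sum_itv_le_lebesgue n (u v : 'I_n -> R) U d : open U ->
  (lebesgue_measure U < d%:E)%E ->
  (forall k, u k <= v k) -> trivIset [set: 'I_n] (fun k => `]u k, v k[%classic) ->
  (forall k, `]u k, v k[ `<=` U) -> \sum_(k < n) (v k - u k) < d.
Proof.
move=> oU Ud uv tI uvU; rewrite -lte_fin; apply: le_lt_trans Ud.
have -> : (\sum_(k < n) (v k - u k))%:E =
    (\sum_(k < n) lebesgue_measure (`]u k, v k[%classic : set R))%E.
  rewrite -sumEFin; apply: eq_bigr => k _.
  rewrite lebesgue_measure_itv/= lte_fin EFinB.
  have := uv k; rewrite le_eqVlt => /predU1P[->|->//].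
  by rewrite ltxx subee.
rewrite -measure_bigsetU_ord//; apply: le_measure; rewrite ?inE.
- by apply: bigsetU_measurable => k _; exact: measurable_itv.
- exact: open_measurable.
- by apply: (big_ind (fun X => X `<=` U)) => // X Y XU YU t [/XU|/YU].
Qed.

Lemma is_derive0_slope f x e : 0 < e -> is_derive x 1 f 0 ->
  exists2 h, 0 < h & forall y, `|y - x| < h -> `|f y - f x| <= e * `|y - x|.
Proof.
move=> e0 [df Df].
have := df; rewrite /derivable => /cvg_toP/(_ Df).
move=> /cvgr0Pnorm_lt /(_ _ e0) /nbhs_norm0P [h /= h0 Hh]; exists h => // y yx.
have [->|yxN] := eqVneq y x; first by rewrite !subrr normr0 mulr0.
have /= := Hh (y - x) yx; rewrite subr_eq0 => /(_ yxN).
rewrite /shift/= [_ *: 1]mulr1 subrK normrM normfV.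
rewrite mulrC ltr_pdivrMr ?normr_gt0 ?subr_eq0// => /ltW; exact.
Qed.

(** The exceptional null set is covered by an open set [U] of measure so small
    that, by absolute continuity, [f] varies little over disjoint intervals
    inside [U]; elsewhere the slope of [f] is small near each point. *)
Lemma abs_cont_derive0 a b f : a <= b -> abs_cont a b f ->
  {ae lebesgue_measure, forall t : R, a < t < b -> is_derive t 1 f 0} ->
  f b = f a.
Proof.
move=> ab acf f'0; apply/eqP; rewrite -subr_eq0 -normr_le0.
apply/ler_addgt0Pl => e' e'0; rewrite addr0.
pose e := e' / (b - a + 1).
have ba1 : 0 < b - a + 1 by rewrite ltr_wpDl ?subr_ge0.
have e0 : 0 < e by rewrite divr_gt0.
have [d d0 Hd] := acf e e0.
(* the end points join the null set, as nothing is known there *)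
have neg1 (t : R) : lebesgue_measure.-negligible [set t].
  by exists [set t]; split=> //; exact: lebesgue_measure_set1.
have := negligibleU f'0 (negligibleU (neg1 a) (neg1 b)).
move=> [B [mB B0 NB]].
have [|U [oU BU UBd]] := @lebesgue_regularity_outer R B d mB _ d0.
  by rewrite B0 ltry.
have Ud : (lebesgue_measure U < d%:E)%E.
  apply: le_lt_trans UBd; rewrite -[leRHS]adde0 -[X in (_ + X)%E]B0.
  rewrite -{1}(setDUK BU) setUC; apply: measureU2 => //.
  by apply: measurableD => //; exact: open_measurable.
have [n [u [v [uv tI uvU fab]]]] : small_outside U f e a b.
  apply: small_outside_total => //; first exact: ltW.
  move=> x /andP[ax xb]; have [Ux|Ux] := pselect (U x).
    have /nbhs_ballP[h /= h0 hU] := open_nbhs_nbhs (conj oU Ux).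
    exists h => // s y _ sx xy _ xs yx; left => t /=; rewrite in_itv/= => /andP[st ty].
    by apply: hU; rewrite /ball/= ltr_distlC; apply/andP; split; lra.
  have xB : ~ B x by move=> /BU.
  have xa : x != a by apply/eqP => xa; apply: xB; apply: NB; right; left.
  have xbN : x != b by apply/eqP => xa'; apply: xB; apply: NB; right; right.
  have fx : is_derive x 1 f 0.
    apply: contrapT => fx; apply: xB; apply: NB; left => H; apply: fx; apply: H.
    by rewrite !lt_neqAle eq_sym xa ax xbN xb.
  have [h h0 hf] := is_derive0_slope _ _ _ e0 fx.
  exists h => // s y _ sx xy _ xs yx; right.
  have -> : f y - f s = (f y - f x) - (f s - f x) by ring.
  apply: le_trans (ler_normB _ _) _.
  have -> : e * (y - s) = e * `|y - x| + e * `|s - x|.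
    by rewrite ger0_norm ?subr_ge0// ler0_norm ?subr_le0//; ring.
  by apply: lerD; apply: hf; rewrite ltr_norml; apply/andP; split; lra.
apply: le_trans fab _.
have := Hd n u v uv tI (sum_itv_le_lebesgue _ _ _ _ _ oU Ud
  (fun k => let: And3 _ h _ := uv k in h) tI uvU).
move=> /ltW /(lerD (lexx (e * (b - a)))) /le_trans; apply.
by rewrite -[X in _ + X]mulr1 -mulrDr /e divfK// gt_eqF.
Qed.

End zero_derivative.

(** * Tails of nonnegative series *)

Section nonnegative_series.
Context {R : realType} (u : nat -> R) (u_ge0 : forall j, (1 <= j)%N -> 0 <= u j)
  (u_summable : (\sum_(1 <= j <oo) (u j)%:E < +oo)%E).

Lemma sum_nat_le_eseries m n : (1 <= m)%N ->
  \sum_(m <= j < n) u j <= fine (\sum_(1 <= j <oo) (u j)%:E)%E.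
Proof.
move=> m1; have u0 j : (1 <= j)%N -> true -> (0 <= (u j)%:E)%E.
  by move=> j1 _; rewrite lee_fin u_ge0.
have fn : (\sum_(1 <= j <oo) (u j)%:E)%E \is a fin_num.
  by rewrite ge0_fin_numE//; exact: nneseries_ge0.
rewrite -lee_fin fineK//; apply: le_trans (nneseries_lim_ge n _); last first.
  by move=> j j1 _; exact: u0.
rewrite sumEFin lee_fin.
have [mn|/ltnW nm] := leqP m n; last first.
  by rewrite [leLHS]big_geq// big_nat_cond sumr_ge0// => j /andP[/andP[+ _] _]; exact: u_ge0.
rewrite [leRHS](big_cat_nat m1 mn)/= lerDr.
by rewrite big_nat_cond sumr_ge0// => j /andP[/andP[+ _] _]; exact: u_ge0.
Qed.

Lemma sum_nat_nondecreasing m : (1 <= m)%N ->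
  nondecreasing_seq (fun n => \sum_(m <= j < n) u j).
Proof.
move=> m1; apply/nondecreasing_seqP => n.
have [mn|nm] := leqP m n; last by rewrite !big_geq// ltnW.
by rewrite big_nat_recr//= lerDl u_ge0// (leq_trans m1).
Qed.

Lemma cvg_tail_sum N :
  (fun n => \sum_(N.+1 <= j < n) u j) @ \oo --> tail_sum u N.
Proof.
apply: nondecreasing_is_cvgn; first exact: sum_nat_nondecreasing.
exists (fine (\sum_(1 <= j <oo) (u j)%:E)%E) => _ [n _ <-].
exact: sum_nat_le_eseries.
Qed.

Lemma sum_nat_le_tail_sum N n : \sum_(N.+1 <= j < n) u j <= tail_sum u N.
Proof.
have c := cvg_tail_sum N.
rewrite -(cvg_lim _ c)//; apply: nondecreasing_cvgn_le.
  exact: sum_nat_nondecreasing.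
by apply/cvg_ex; eexists; exact: c.
Qed.

Lemma tail_sum_ge0 N : 0 <= tail_sum u N.
Proof. by have := sum_nat_le_tail_sum N 0; rewrite big_geq. Qed.

Lemma tail_sumS N : tail_sum u N = u N.+1 + tail_sum u N.+1.
Proof.
have h : (fun n => u N.+1 + \sum_(N.+2 <= j < n) u j) @ \oo -->
    u N.+1 + tail_sum u N.+1.
  by apply: cvgD; [exact: cvg_cst|exact: cvg_tail_sum].
suff h' : (fun n => \sum_(N.+1 <= j < n) u j) @ \oo --> u N.+1 + tail_sum u N.+1.
  exact: (cvg_unique (@Rhausdorff R) (cvg_tail_sum N) h').
apply: cvg_trans h.
apply: near_eq_cvg; near=> n; rewrite [RHS]big_ltn//.
by near: n; exact: nbhs_infty_gt.
Unshelve. all: by end_near. Qed.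

Lemma tail_sum_noninc M N : (M <= N)%N -> tail_sum u N <= tail_sum u M.
Proof.
elim: N => [|N IH]; first by rewrite leqn0 => /eqP ->.
rewrite leq_eqVlt => /predU1P[->//|MN]; apply: le_trans (IH MN).
by rewrite [leRHS]tail_sumS lerDr u_ge0.
Qed.

End nonnegative_series.

(** * The solution over one interval *)

Section recursion.
Context {R : realType}.
Implicit Types (a b m r t : R) (v w : R * R).

(** The scalar product of [w] with [xi a]. *)
Definition proj a w : R := cos a * w.1 + sin a * w.2.

(** The effect of an interval of angle [a] on the real part [w] of the row,
    whose imaginary part is [v]; here [m] is [r] times the length.  As
    multiplication by [ir] exchanges the two parts up to a sign, the effect on
    the imaginary part is [kick (- m) a w v]. *)
Definition kick m a v w : R * R :=
  (w.1 + m * proj a v * sin a, w.2 - m * proj a v * cos a).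

Lemma proj_kick b m a v w :
  proj b (kick m a v w) = proj b w + m * proj a v * sin (a - b).
Proof. by rewrite sinB /kick /proj/=; ring. Qed.

Lemma proj_rot a b w :
  proj b w = cos (b - a) * proj a w + sin (b - a) * proj (a + pi / 2) w.
Proof.
rewrite /proj cosDpihalf sinDpihalf cosB sinB.
have := cos2Dsin2 a => h.
transitivity ((cos a ^+ 2 + sin a ^+ 2) * (cos b * w.1 + sin b * w.2)).
  by rewrite h mul1r.
ring.
Qed.

Lemma lebesgue_aeS (P Q : R -> Prop) : (forall t, P t -> Q t) ->
  {ae lebesgue_measure, forall t, P t} -> {ae lebesgue_measure, forall t, Q t}.
Proof. by move=> PQ; apply: negligibleS => t /= nQ /PQ. Qed.

(** The component of the solution along [xi phi] is constant by
    [abs_cont_derive0], hence the derivatives are constant, and the same lemma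
    applies to the difference with an affine function. *)
Lemma canonical_step a b r phi (x1 x2 y1 y2 : R -> R) : a <= b ->
  abs_cont a b x1 -> abs_cont a b x2 -> abs_cont a b y1 -> abs_cont a b y2 ->
  let px t := cos phi * x1 t + sin phi * x2 t in
  let py t := cos phi * y1 t + sin phi * y2 t in
  {ae lebesgue_measure, forall t : R, a < t < b ->
    [/\ is_derive t 1 x1 (r * py t * sin phi),
        is_derive t 1 x2 (- (r * py t * cos phi)),
        is_derive t 1 y1 (- (r * px t * sin phi))
      & is_derive t 1 y2 (r * px t * cos phi)]} ->
  (x1 b, x2 b) = kick (r * (b - a)) phi (y1 a, y2 a) (x1 a, x2 a) /\
  (y1 b, y2 b) = kick (- (r * (b - a))) phi (x1 a, x2 a) (y1 a, y2 a).
Proof.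
move=> ab ax1 ax2 ay1 ay2 px py der.
have derlin (c d : R) (f g : R -> R) t (f' g' : R) :
    is_derive t 1 f f' -> is_derive t 1 g g' ->
    is_derive t 1 (fun t => c * f t + d * g t) (c * f' + d * g').
  by move=> df dg; exact: is_deriveD (is_deriveZ c df) (is_deriveZ d dg).
have aclin (c d : R) f g : abs_cont a b f -> abs_cont a b g ->
    abs_cont a b (fun t => c * f t + d * g t).
  by move=> af ag; exact: abs_contD (abs_contZ _ _ _ c _ af) (abs_contZ _ _ _ d _ ag).
have const (f : R -> R) : abs_cont a b f ->
    {ae lebesgue_measure, forall t : R, a < t < b -> is_derive t 1 f 0} ->
    forall t, a <= t <= b -> f t = f a.
  move=> af f'0 t /andP[at_ tb]; apply: (abs_cont_derive0 _ _ _ at_).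
    exact: abs_contS af.
  apply: lebesgue_aeS f'0 => s f'0 /andP[as_ st]; apply: f'0.
  by rewrite as_ (lt_le_trans st).
have pxC : forall t, a <= t <= b -> px t = px a.
  apply: const; first exact: aclin.
  apply: lebesgue_aeS der => t der /der[dx1 dx2 _ _].
  by apply: (is_derive_eq (derlin (cos phi) (sin phi) _ _ _ _ _ dx1 dx2)); ring.
have pyC : forall t, a <= t <= b -> py t = py a.
  apply: const; first exact: aclin.
  apply: lebesgue_aeS der => t der /der[_ _ dy1 dy2].
  by apply: (is_derive_eq (derlin (cos phi) (sin phi) _ _ _ _ _ dy1 dy2)); ring.
have affine (f : R -> R) k : abs_cont a b f ->
    {ae lebesgue_measure, forall t : R, a < t < b -> is_derive t 1 f k} ->
    f b = f a + k * (b - a).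
  move=> af f'k.
  have := const (fun t => 1 * f t + (- k) * id t)
    (aclin _ _ _ _ af (abs_cont_id _ _ _)).
  have h : {ae lebesgue_measure, forall t : R, a < t < b ->
      is_derive t 1 (fun t => 1 * f t + (- k) * id t) 0}.
    apply: lebesgue_aeS f'k => t f'k /f'k dft.
    by apply: (is_derive_eq (derlin 1 (- k) _ _ _ _ _ dft (is_derive_id _ _))); ring.
  move=> /(_ h b); rewrite ab lexx => /(_ isT) /= e.
  by move: e; lra.
have itvW t : a < t < b -> a <= t <= b by move=> /andP[/ltW -> /ltW ->].
rewrite /kick /proj/=; split; congr pair.
- rewrite (affine x1 (r * py a * sin phi))//; first by rewrite /py; ring.
  by apply: lebesgue_aeS der => t der tab; have [+ _ _ _] := der tab; rewrite pyC// itvW.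
- rewrite (affine x2 (- (r * py a * cos phi)))//; first by rewrite /py; ring.
  by apply: lebesgue_aeS der => t der tab; have [_ + _ _] := der tab; rewrite pyC// itvW.
- rewrite (affine y1 (- (r * px a * sin phi)))//; first by rewrite /px; ring.
  by apply: lebesgue_aeS der => t der tab; have [_ _ + _] := der tab; rewrite pxC// itvW.
- rewrite (affine y2 (r * px a * cos phi))//; first by rewrite /px; ring.
  by apply: lebesgue_aeS der => t der tab; have [_ _ _ +] := der tab; rewrite pxC// itvW.
Qed.

End recursion.

(** * Recursion for the second row at the nodes *)

Section monodromy.
Context {R : realType}.
Implicit Types (l phi : nat -> R) (H : R -> 'M[R]_2) (W : R -> 'M[R[i]]_2).

Lemma abs_Re_le_normc (z : R[i]) : `|complex.Re z| <= ComplexField.Normc.normc z.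
Proof.
case: z => a b /=; rewrite -sqrtr_sqr; apply: ler_wsqrtr.
by rewrite lerDl sqr_ge0.
Qed.

Lemma abs_Im_le_normc (z : R[i]) : `|complex.Im z| <= ComplexField.Normc.normc z.
Proof.
case: z => a b /=; rewrite -sqrtr_sqr; apply: ler_wsqrtr.
by rewrite lerDr sqr_ge0.
Qed.

Lemma normc_le_Re_Im (z : R[i]) :
  ComplexField.Normc.normc z <= `|complex.Re z| + `|complex.Im z|.
Proof.
case: z => a b /=; rewrite -(ler_pXn2r (n := 2)) ?nnegrE ?sqrtr_ge0 ?addr_ge0//.
rewrite sqr_sqrtr ?addr_ge0 ?sqr_ge0// sqrrD !real_normK ?num_real//.
by rewrite addrAC lerDl mulrn_wge0 ?mulr_ge0.
Qed.

Lemma abs_cont_Re a b (f : R -> R[i]) : absolutely_continuous_on a b f ->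
  abs_cont a b (fun t => complex.Re (f t)).
Proof.
move=> af e /af[d d0 Hd]; exists d => // n u v uv tI sd.
apply: le_lt_trans (Hd n u v uv tI sd); apply: ler_sum => k _.
by apply: le_trans (abs_Re_le_normc _); case: (f (v k)) (f (u k)) => ? ? [].
Qed.

Lemma abs_cont_Im a b (f : R -> R[i]) : absolutely_continuous_on a b f ->
  abs_cont a b (fun t => complex.Im (f t)).
Proof.
move=> af e /af[d d0 Hd]; exists d => // n u v uv tI sd.
apply: le_lt_trans (Hd n u v uv tI sd); apply: ler_sum => k _.
by apply: le_trans (abs_Im_le_normc _); case: (f (v k)) (f (u k)) => ? ? [].
Qed.

Lemma nodeS l n : node l n.+1 = node l n + l n.+1.
Proof. by rewrite /node big_nat_recr. Qed.

Lemma node_ge0 l n : (forall j, (1 <= j)%N -> 0 < l j) -> 0 <= node l n.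
Proof.
move=> l0; elim: n => [|n IH]; first by rewrite /node big_geq.
by rewrite nodeS addr_ge0// ltW// l0.
Qed.

(** Real part of the second row. *)
Definition rowRe W t : R * R :=
  (complex.Re (W t ord_max ord0), complex.Re (W t ord_max ord_max)).

(** Imaginary part of the second row. *)
Definition rowIm W t : R * R :=
  (complex.Im (W t ord_max ord0), complex.Im (W t ord_max ord_max)).

(** The differential equation in real coordinates, for the spectral parameter
    [ir] and the angle [a]. *)
Lemma canonical_row2 W t (D : 'M[R[i]]_2) a r : is_derive_mx W t D ->
  D *m Jmx _ = (0 +i* r)%C *: (W t *m map_mx (real_complex R) (xi a *m (xi a)^T)) ->
  [/\ is_derive t 1 (fun s => (rowRe W s).1) (r * proj a (rowIm W t) * sin a),
      is_derive t 1 (fun s => (rowRe W s).2) (- (r * proj a (rowIm W t) * cos a)),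
      is_derive t 1 (fun s => (rowIm W s).1) (- (r * proj a (rowRe W t) * sin a))
    & is_derive t 1 (fun s => (rowIm W s).2) (r * proj a (rowRe W t) * cos a)].
Proof.
move=> dW /matrixP E.
have lift01 : lift ord0 ord0 = ord_max :> 'I_2 by exact/val_inj.
have := E ord_max ord0; have := E ord_max ord_max.
rewrite !mxE !big_ord_recl !big_ord0 !mxE !big_ord_recl !big_ord0 !mxE.
rewrite !lift01 /=.
have := dW ord_max ord0; have := dW ord_max ord_max.
rewrite /rowRe /rowIm /proj/=.
case: (D ord_max ord0) => d1 d2; case: (D ord_max ord_max) => d3 d4.
case: (W t ord_max ord0) => w1 w2; case: (W t ord_max ord_max) => w3 w4 /=.
move=> [r2 i2] [r1 i1].
move=> /eqP; rewrite eq_complex /= => /andP[/eqP e1 /eqP e2].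
move=> /eqP; rewrite eq_complex /= => /andP[/eqP e3 /eqP e4].
split.
- by apply: (is_derive_eq r1); lra.
- by apply: (is_derive_eq r2); lra.
- by apply: (is_derive_eq i1); lra.
- by apply: (is_derive_eq i2); lra.
Qed.

Lemma row2_recursion l phi H W r :
  limit_circle_Hamburger l phi H ->
  fundamental_solution H (total_length l) (0 +i* r)%C W ->
  forall n,
    rowRe W (node l n.+1) = kick (r * l n.+1) (phi n.+1)
      (rowIm W (node l n)) (rowRe W (node l n)) /\
    rowIm W (node l n.+1) = kick (- (r * l n.+1)) (phi n.+1)
      (rowRe W (node l n)) (rowIm W (node l n)).
Proof.
move=> [l0 ls _ Hxi] [acW _ W'] n.
have nn : node l n <= node l n.+1 by rewrite nodeS lerDl ltW// l0.
have nL : node l n.+1 <= total_length l.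
  by apply: sum_nat_le_tail_sum => // j j1; exact/ltW/l0.
have ac i j (g : R[i] -> R) :
    (forall f, absolutely_continuous_on 0 (total_length l) f ->
       abs_cont 0 (total_length l) (fun t => g (f t))) ->
    abs_cont (node l n) (node l n.+1) (fun t => g (W t i j)).
  by move=> /(_ _ (acW i j)); apply: abs_contS => //; exact: node_ge0.
have -> : l n.+1 = node l n.+1 - node l n by rewrite nodeS addrAC subrr add0r.
apply: (canonical_step _ _ r (phi n.+1) (fun t => (rowRe W t).1)
  (fun t => (rowRe W t).2) (fun t => (rowIm W t).1) (fun t => (rowIm W t).2)) => //;
  try by apply: ac => f; first [exact: abs_cont_Re|exact: abs_cont_Im].
apply: lebesgue_aeS W' => t W' /andP[nt tn].
have [|D dW E] := W'.
  by rewrite (le_lt_trans (node_ge0 _ _ _) nt)// (lt_le_trans tn).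
apply: (canonical_row2 _ _ _ _ _ dW); rewrite E (Hxi n.+1)//.
by rewrite (ltW nt) tn.
Qed.

Lemma row2_start H L z W : fundamental_solution H L z W ->
  rowRe W 0 = (0, 1) /\ rowIm W 0 = (0, 0).
Proof. by move=> [_ W0 _]; rewrite /rowRe /rowIm W0 !mxE. Qed.

(** The bound passes to the right end of the interval by continuity. *)
Lemma monodromy22_le l phi H W z n0 M :
  limit_circle_Hamburger l phi H ->
  fundamental_solution H (total_length l) z W ->
  (forall n, (n0 <= n)%N ->
     `|(rowRe W (node l n)).2| + `|(rowIm W (node l n)).2| <= M) ->
  ComplexField.Normc.normc (W (total_length l) ord_max ord_max) <= M.
Proof.
move=> [l0 ls _ _] [acW _ _] HM.
have l0' j : (1 <= j)%N -> 0 <= l j by move=> /l0/ltW.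
apply: le_trans (normc_le_Re_Im _) _; apply/ler_addgt0Pr => e e0.
have e2 : 0 < e / 2 by rewrite divr_gt0.
have [d d0 Hd] := abs_cont_Re _ _ _ (acW ord_max ord_max) _ e2.
have [d' d'0 Hd'] := abs_cont_Im _ _ _ (acW ord_max ord_max) _ e2.
have cN := cvg_tail_sum _ l0' ls 0.
have m0 : 0 < Num.min d d' by rewrite lt_min d0.
move: cN => /cvgrPdist_lt /(_ _ m0) [N _ HN].
pose n := maxn n0 N.
have /= := HN n.+1 (leqW (leq_maxr _ _)); rewrite -/(node l n).
rewrite -/(total_length l) lt_min => /andP[nd nd'].
have nL : node l n <= total_length l by exact: sum_nat_le_tail_sum.
have uv : forall k : 'I_1, [/\ 0 <= node l n, node l n <= total_length l &
    total_length l <= total_length l] by split=> //; exact: node_ge0.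
have tI : trivIset [set: 'I_1] (fun=> `]node l n, total_length l[%classic).
  by move=> i j _ _ _; rewrite !ord1.
have := Hd 1%N (fun=> node l n) (fun=> total_length l) uv tI.
have := Hd' 1%N (fun=> node l n) (fun=> total_length l) uv tI.
rewrite !big_ord1 => /(_ (le_lt_trans (ler_norm _) nd')) h'.
move=> /(_ (le_lt_trans (ler_norm _) nd)) h.
have := HM n (leq_maxl _ _); rewrite /rowRe /rowIm /= => hM.
have := ler_normD (complex.Re (W (total_length l) ord_max ord_max) -
   complex.Re (W (node l n) ord_max ord_max)) (complex.Re (W (node l n) ord_max ord_max)).
have := ler_normD (complex.Im (W (total_length l) ord_max ord_max) -
   complex.Im (W (node l n) ord_max ord_max)) (complex.Im (W (node l n) ord_max ord_max)).
rewrite !subrK; lra.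
Qed.

End monodromy.

(** * Weighted norms of the row *)

Section weighted_norms.
Context {R : realType}.
Implicit Types (a b e m : R) (x y w : R * R).

(** [comp_size a x y] is the size of the component along [xi a] of the row with
    real part [x] and imaginary part [y]; [comp_size (a + pi / 2) x y] is the
    size of the orthogonal component. *)
Definition comp_size a x y : R := `|proj a x| + `|proj a y|.

(** The norm with weights [c] and [d] in the frame of angle [a]. *)
Definition wnorm c d a x y : R :=
  c * comp_size a x y + d * comp_size (a + pi / 2) x y.

(** The sum of the absolute values of the four real coordinates of the row. *)
Definition norm1 x y : R := `|x.1| + `|x.2| + (`|y.1| + `|y.2|).

(** The square of the Euclidean norm of the row. *)
Definition sqnorm x y : R := x.1 ^+ 2 + x.2 ^+ 2 + (y.1 ^+ 2 + y.2 ^+ 2).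

Lemma comp_size_ge0 a x y : 0 <= comp_size a x y. Proof. exact: addr_ge0. Qed.

Lemma wnorm_ge0 c d a x y : 0 <= c -> 0 <= d -> 0 <= wnorm c d a x y.
Proof. by move=> c0 d0; rewrite addr_ge0// mulr_ge0// comp_size_ge0. Qed.

Lemma comp_size_le_norm1 a x y : comp_size a x y <= norm1 x y.
Proof.
have h w : `|proj a w| <= `|w.1| + `|w.2|.
  apply: le_trans (ler_normD _ _) _; rewrite !normrM.
  by apply: lerD; rewrite ler_piMl ?sin_max ?cos_max.
exact: lerD.
Qed.

Lemma comp_size_rot a b x y : comp_size b x y <=
  `|cos (b - a)| * comp_size a x y + `|sin (b - a)| * comp_size (a + pi / 2) x y.
Proof.
have h w : `|proj b w| <= `|cos (b - a)| * `|proj a w| +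
    `|sin (b - a)| * `|proj (a + pi / 2) w|.
  by rewrite (proj_rot a) -!normrM ler_normD.
by rewrite /comp_size !mulrDr addrACA; exact: lerD.
Qed.

Lemma norm1_le_comp_size a x y :
  norm1 x y <= 2 * (comp_size a x y + comp_size (a + pi / 2) x y).
Proof.
have h w : `|w.1| + `|w.2| <= 2 * (`|proj a w| + `|proj (a + pi / 2) w|).
  have E1 : w.1 = cos a * proj a w - sin a * proj (a + pi / 2) w.
    rewrite /proj cosDpihalf sinDpihalf.
    by transitivity ((cos a ^+ 2 + sin a ^+ 2) * w.1); [rewrite cos2Dsin2 mul1r|ring].
  have E2 : w.2 = sin a * proj a w + cos a * proj (a + pi / 2) w.
    rewrite /proj cosDpihalf sinDpihalf.
    by transitivity ((cos a ^+ 2 + sin a ^+ 2) * w.2); [rewrite cos2Dsin2 mul1r|ring].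
  have bd c t : `|c| <= 1 -> `|c * t| <= `|t| :> R by move=> c1; rewrite normrM ler_piMl.
  have h1 : `|w.1| <= `|proj a w| + `|proj (a + pi / 2) w|.
    rewrite E1; apply: le_trans (ler_normB _ _) _.
    by apply: lerD; apply: bd; [exact: cos_max|exact: sin_max].
  have h2 : `|w.2| <= `|proj a w| + `|proj (a + pi / 2) w|.
    rewrite E2; apply: le_trans (ler_normD _ _) _.
    by apply: lerD; apply: bd; [exact: sin_max|exact: cos_max].
  lra.
rewrite /norm1 /comp_size; have := h x; have := h y; lra.
Qed.

Lemma comp_size_kick b m a x y : 0 <= m ->
  comp_size b (kick m a y x) (kick (- m) a x y) <=
  comp_size b x y + m * `|sin (a - b)| * comp_size a x y.
Proof.
move=> m0; rewrite /comp_size !proj_kick.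
have h (u v : R) : `|u + m * v * sin (a - b)| <= `|u| + m * `|sin (a - b)| * `|v|.
  apply: le_trans (ler_normD _ _) _; rewrite !normrM (ger0_norm m0); lra.
have h' (u v : R) : `|u + - m * v * sin (a - b)| <= `|u| + m * `|sin (a - b)| * `|v|.
  by have := h u (- v); rewrite normrN mulrN -mulNr.
have := h (proj b x) (proj a y); have := h' (proj b y) (proj a x); lra.
Qed.

Lemma comp_size_kick_orth b m a x y : 0 <= m ->
  comp_size (b + pi / 2) (kick m a y x) (kick (- m) a x y) <=
  comp_size (b + pi / 2) x y + m * `|cos (a - b)| * comp_size a x y.
Proof.
move=> m0; apply: le_trans (comp_size_kick _ _ _ _ _ m0) _.
by rewrite opprD addrA sinBpihalf normrN.
Qed.

(** In the frame of its own angle, [kick] only changes the orthogonal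
    component. *)
Lemma wnorm_kick_own e m a x y : 0 <= e -> 0 <= m ->
  wnorm 1 e a (kick m a y x) (kick (- m) a x y) <= (1 + e * m) * wnorm 1 e a x y.
Proof.
move=> e0 m0; rewrite /wnorm.
have := comp_size_kick a m a x y m0.
have := ler_wpM2l e0 (comp_size_kick_orth a m a x y m0).
rewrite subrr sin0 cos0 normr0 normr1.
have : 0 <= e * m * (e * comp_size (a + pi / 2) x y).
  by rewrite !mulr_ge0// comp_size_ge0.
lra.
Qed.

Lemma wnorm_rot e a b x y : 0 < e -> e <= 1 ->
  wnorm 1 e b x y <= (1 + `|sin (b - a)| / e) * wnorm 1 e a x y.
Proof.
move=> e0 e1; rewrite /wnorm !mul1r.
set s := `|sin (b - a)|; set c := `|cos (b - a)|.
have h1 : comp_size b x y <= c * comp_size a x y + s * comp_size (a + pi / 2) x y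
  by exact: comp_size_rot.
have h2 : comp_size (b + pi / 2) x y <= s * comp_size a x y + c * comp_size (a + pi / 2) x y.
  have := comp_size_rot a (b + pi / 2) x y.
  by rewrite addrAC cosDpihalf sinDpihalf normrN.
have c1 : c <= 1 by exact: cos_max.
have s0 : 0 <= s by exact: normr_ge0.
set p := comp_size a x y in h1 h2 *; set q := comp_size (a + pi / 2) x y in h1 h2 *.
have p0 : 0 <= p by exact: comp_size_ge0.
have q0 : 0 <= q by exact: comp_size_ge0.
have h3 := ler_wpM2l (ltW e0) h2.
have h4 : c * p <= p by rewrite ler_piMl.
have h5 : e * (c * q) <= e * q by rewrite ler_wpM2l// ?ler_piMl// ltW.
have h6 : e * (s * p) <= s / e * p.
  rewrite mulrA ler_wpM2r// mulrC ler_wpM2l//.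
  by rewrite (le_trans e1)// invf_ge1.
have h7 : s * q = s / e * (e * q) by field; rewrite gt_eqF.
rewrite (mulrDl 1) mul1r (mulrDr (s / e)) -h7; lra.
Qed.

Lemma wnorm_kick b m a c x y : 1 <= b -> 0 <= m ->
  wnorm b 1 c (kick m a y x) (kick (- m) a x y) <=
  (1 + 2 * m * (b * sin (a - c) ^+ 2 + b^-1)) * wnorm b 1 c x y.
Proof.
move=> b1 m0; have b0 : 0 < b by exact: lt_le_trans b1.
rewrite /wnorm !mul1r.
have h1 := comp_size_kick c m a x y m0; have h2 := comp_size_kick_orth c m a x y m0.
have h3 := comp_size_rot c a x y.
have c1 := cos_max (a - c).
rewrite -[sin (a - c) ^+ 2](real_normK (num_real _)).
set s := `|sin (a - c)| in h1 h2 h3 *.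
set d := `|cos (a - c)| in h1 h2 h3 c1 *.
have s0 : 0 <= s by exact: normr_ge0.
have d0 : 0 <= d by exact: normr_ge0.
set p := comp_size c x y in h1 h2 h3 *.
set q := comp_size (c + pi / 2) x y in h1 h2 h3 *.
set t := comp_size a x y in h1 h2 h3 *.
have p0 : 0 <= p by exact: comp_size_ge0.
have q0 : 0 <= q by exact: comp_size_ge0.
set k := b * s ^+ 2 + b^-1.
have k0 : 0 <= k by rewrite addr_ge0// ?mulr_ge0 ?sqr_ge0// ?invr_ge0 ltW.
have sd : 2 * (s * d) <= k.
  have : 0 <= (b * s - d) ^+ 2 / b by rewrite divr_ge0 ?sqr_ge0// ltW.
  have -> : (b * s - d) ^+ 2 / b = b * s ^+ 2 - 2 * (s * d) + d ^+ 2 * b^-1.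
    by field; rewrite gt_eqF.
  have : d ^+ 2 * b^-1 <= b^-1 by rewrite ler_piMl ?expr_le1 ?invr_ge0// ltW.
  rewrite /k; lra.
have main : (b * s + d) * t <= 2 * k * (b * p + q).
  apply: le_trans (ler_wpM2l _ h3) _; first by rewrite addr_ge0// mulr_ge0// ltW.
  have -> : (b * s + d) * (d * p + s * q) =
     (s * d) * (b * p) + (d ^+ 2 / b) * (b * p) + (b * s ^+ 2) * q + (s * d) * q.
    by field; rewrite gt_eqF.
  have bp0 : 0 <= b * p by rewrite mulr_ge0// ltW.
  have i1 : s * d * (b * p) <= k * (b * p).
    by rewrite ler_wpM2r//; have := mulr_ge0 s0 d0; lra.
  have i2 : d ^+ 2 / b * (b * p) <= k * (b * p).
    rewrite ler_wpM2r// /k.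
    have : d ^+ 2 * b^-1 <= b^-1 by rewrite ler_piMl ?expr_le1 ?invr_ge0// ltW.
    have : 0 <= b * s ^+ 2 by rewrite mulr_ge0 ?sqr_ge0// ltW.
    lra.
  have i3 : b * s ^+ 2 * q <= k * q.
    by rewrite ler_wpM2r// /k lerDl invr_ge0 ltW.
  have i4 : s * d * q <= k * q.
    by rewrite ler_wpM2r//; have := mulr_ge0 s0 d0; lra.
  lra.
have := ler_wpM2l m0 main; have := ler_wpM2l (ltW b0) h1; lra.
Qed.

Lemma sqnorm_proj a x y : sqnorm x y =
  proj a x ^+ 2 + proj (a + pi / 2) x ^+ 2 +
  (proj a y ^+ 2 + proj (a + pi / 2) y ^+ 2).
Proof.
rewrite /sqnorm /proj cosDpihalf sinDpihalf.
transitivity ((cos a ^+ 2 + sin a ^+ 2) *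
  (x.1 ^+ 2 + x.2 ^+ 2 + (y.1 ^+ 2 + y.2 ^+ 2))); last by ring.
by rewrite cos2Dsin2 mul1r.
Qed.

Lemma sqnorm_kick m a x y : 0 <= m ->
  sqnorm (kick m a y x) (kick (- m) a x y) <= (1 + m) ^+ 2 * sqnorm x y.
Proof.
move=> m0; rewrite !(sqnorm_proj a) !proj_kick (_ : a - (a + pi / 2) = - (pi / 2)); last by ring.
rewrite (subrr a) sin0.
rewrite sinN sin_pihalf.
set p := proj a x; set q := proj a y.
set u := proj _ x; set v := proj _ y.
have h : (2 * m + m ^+ 2) * (u ^+ 2 + v ^+ 2) + m * (p ^+ 2 + q ^+ 2) +
   m * ((q + u) ^+ 2 + (p - v) ^+ 2) + m * 0 >= 0.
  by rewrite !addr_ge0// ?mulr0// !mulr_ge0// ?addr_ge0 ?sqr_ge0// mulr_ge0.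
have h' : 0 <= m ^+ 2 * (u ^+ 2 + v ^+ 2) by rewrite mulr_ge0 ?addr_ge0 ?sqr_ge0.
have hm : 0 <= m * ((q + u) ^+ 2 + (p - v) ^+ 2).
  by rewrite mulr_ge0// addr_ge0 ?sqr_ge0.
have hu : 0 <= m * (u ^+ 2 + v ^+ 2) by rewrite mulr_ge0 ?addr_ge0 ?sqr_ge0.
have hp : 0 <= m * (p ^+ 2 + q ^+ 2) by rewrite mulr_ge0 ?addr_ge0 ?sqr_ge0.
lra.
Qed.

Lemma norm1_le_sqnorm x y : norm1 x y <= 4 + sqnorm x y.
Proof.
have h (t : R) : `|t| <= 1 + t ^+ 2.
  rewrite -[t ^+ 2](real_normK (num_real _)).
  have := sqr_ge0 (`|t| - 1); have := normr_ge0 t; lra.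
rewrite /norm1 /sqnorm.
have := h x.1; have := h x.2; have := h y.1; have := h y.2; lra.
Qed.

End weighted_norms.

(** * Sums and products *)

Section estimates.
Context {R : realType}.
Implicit Types (alpha beta r t : R) (l phi u v f : nat -> R) (n N : nat).

Lemma powR_expR t r : 0 < t -> t `^ r = expR (r * ln t).
Proof. by move=> t0; rewrite /powR gt_eqF. Qed.

Lemma exp_growth v f n0 :
  (forall n, (n0 <= n)%N -> v n.+1 <= expR (f n.+1) * v n) ->
  forall n, (n0 <= n)%N -> v n <= expR (\sum_(n0.+1 <= j < n.+1) f j) * v n0.
Proof.
move=> vS; elim => [|n IH].
  by rewrite leqn0 => /eqP ->; rewrite big_geq// expR0 mul1r.
rewrite leq_eqVlt => /predU1P[<-|]; first by rewrite big_geq// expR0 mul1r.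
rewrite ltnS => n0n; apply: le_trans (vS n n0n) _.
rewrite big_nat_recr//= expRD [expR _ * expR _]mulrC -mulrA.
by rewrite ler_wpM2l ?expR_ge0// IH.
Qed.

Lemma ler1D_expR_powR alpha t : 1 <= alpha -> 0 <= t ->
  1 + t <= expR (2 * alpha * t `^ (1 / alpha)).
Proof.
move=> a1 t0; have a0 : 0 < alpha by exact: lt_le_trans a1.
have [->|tN0] := eqVneq t 0.
  by rewrite addr0 -[leLHS]expR0 ler_expR !mulr_ge0 ?powR_ge0// ltW.
have tp : 0 < t by rewrite lt_neqAle eq_sym tN0.
have [t1|/ltW t1] := leP t 1.
  apply: le_trans (expR_ge1Dx _) _; rewrite ler_expR.
  have h : t <= t `^ (1 / alpha).
    by apply: ger1_powR; rewrite ?tp ?t1// ler_pdivrMr// mul1r.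
  apply: le_trans h _; rewrite ler_peMl ?powR_ge0//; lra.
set w := t `^ (1 / alpha).
have w0 : 0 < w by rewrite powR_gt0.
have -> : expR (2 * alpha * w) = expR (2 * w) `^ alpha.
  by rewrite -expRM; congr expR; ring.
have wt : w `^ alpha = t by rewrite -powRrM divfK ?gt_eqF// powRr1.
have h : (2 * w) `^ alpha <= expR (2 * w) `^ alpha.
  apply: ge0_ler_powR; rewrite ?nnegrE ?expR_ge0 ?ltW ?mulr_gt0//.
  by apply: lt_le_trans (expR_ge1Dx _); rewrite ltrDr.
apply: le_trans h; rewrite powRM ?(ltW w0)// wt.
have h2 : 2 <= 2 `^ alpha :> R by apply: le1r_powR => //; lra.
have := ler_wpM2r t0 h2; lra.
Qed.

(** A weak form of the Hoelder inequality with exponents [1 / beta] and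
    [1 / (1 - beta)]. *)
Lemma sum_le_powR beta (s : nat -> R) (B : R) n : 0 < beta < 1 -> (1 <= n)%N ->
  (forall j, 0 <= s j) ->
  \sum_(1 <= j < n.+1) s j `^ (1 / beta) <= B ->
  \sum_(1 <= j < n.+1) s j <= n%:R `^ (1 - beta) * (1 + B).
Proof.
move=> /andP[b0 b1] n1 s0 sB.
have n0 : 0 < n%:R :> R by rewrite ltr0n.
have nN0 : n%:R != 0 :> R by rewrite gt_eqF.
(* applied to [n^beta * s j], this bounds each term *)
have key (t : R) : 0 <= t -> t <= 1 + t `^ (1 / beta).
  move=> t0; have [t1|/ltW t1] := leP t 1.
    by apply: le_trans t1 _; rewrite lerDl powR_ge0.
  have : t <= t `^ (1 / beta).
    by apply: le1r_powR => //; rewrite ler_pdivlMr// mul1r ltW.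
  by move=> /le_trans; apply; rewrite lerDr.
have step j : s j <= n%:R `^ (- beta) + n%:R `^ (1 - beta) * s j `^ (1 / beta).
  have := key (n%:R `^ beta * s j) (mulr_ge0 (powR_ge0 _ _) (s0 j)).
  rewrite powRM ?powR_ge0// -powRrM (_ : beta * (1 / beta) = 1); last first.
    by field; rewrite gt_eqF.
  rewrite powRr1 ?(ltW n0)// => h.
  have nb : 0 < n%:R `^ (- beta) :> R by rewrite powR_gt0.
  have := ler_wpM2l (ltW nb) h.
  rewrite mulrA -powRD ?addNr ?powRr0 ?mul1r; last by rewrite nN0 implybT.
  rewrite mulrDr mulr1 mulrA; congr (_ <= _ + _ * _).
  rewrite -{2}[n%:R](@powRr1 R) ?(ltW n0)// -powRD; last by rewrite nN0 implybT.
  by rewrite addrC.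
apply: le_trans (ler_sum_nat (fun j _ => step j)) _.
rewrite big_split/= -mulr_sumr mulrDr mulr1; apply: lerD; last first.
  by rewrite ler_wpM2l// powR_ge0.
rewrite big_const_nat subn1/= iter_addr_0 -[leLHS]mulr_natl.
by rewrite powRD ?nN0 ?implybT// powRr1// ltW.
Qed.

(** The quantity [(r n^(1 - beta))^(1 / (alpha + 1))] that bounds the logarithm
    of the monodromy matrix, up to a constant factor. *)
Definition rate alpha beta r n : R := (r * n%:R `^ (1 - beta)) `^ (1 / (alpha + 1)).

Lemma rateE alpha beta r n : 0 < r -> (1 <= n)%N ->
  rate alpha beta r n = expR ((ln r + (1 - beta) * ln n%:R) / (alpha + 1)).
Proof.
move=> r0 n1; have n0 : 0 < n%:R :> R by rewrite ltr0n.
have h : 0 < n%:R `^ (1 - beta) :> R by rewrite powR_gt0.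
rewrite /rate powR_expR ?mulr_gt0// lnM ?posrE// ln_powR; congr expR.
by rewrite mulrC mul1r.
Qed.

End estimates.

(** * Growth over the first intervals and over the tail *)

Section growth_bounds.
Context {R : realType} (l phi : nat -> R) (r : R) (x y : nat -> R * R).
Context (l0 : forall j, (1 <= j)%N -> 0 < l j) (r1 : 1 <= r)
  (xyS : forall n,
     x n.+1 = kick (r * l n.+1) (phi n.+1) (y n) (x n) /\
     y n.+1 = kick (- (r * l n.+1)) (phi n.+1) (x n) (y n)).

Let r0 : 0 < r. Proof. exact: lt_le_trans r1. Qed.

Let rl0 n : 0 <= r * l n.+1.
Proof. by rewrite mulr_ge0 ?ltW// l0. Qed.

(** An interval followed by the turn to the next angle. *)
Lemma wnorm_frames_step e alpha n : 0 < e -> e <= 1 -> 1 <= alpha ->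
  wnorm 1 e (phi n.+2) (x n.+1) (y n.+1) <=
  expR (2 * alpha * (e * (r * l n.+1)) `^ (1 / alpha) +
        `|sin (phi n.+2 - phi n.+1)| / e) *
  wnorm 1 e (phi n.+1) (x n) (y n).
Proof.
move=> e0 e1 a1.
have w0 := wnorm_ge0 1 e (phi n.+1) (x n) (y n) ler01 (ltW e0).
apply: le_trans (wnorm_rot e (phi n.+1) _ _ _ e0 e1) _.
have s0 : 0 <= `|sin (phi n.+2 - phi n.+1)| / e by rewrite divr_ge0// ltW.
have [-> ->] := xyS n.
rewrite expRD [expR _ * expR _]mulrC -[leRHS]mulrA; apply: ler_pM.
- by rewrite addr_ge0.
- by apply: wnorm_ge0 => //; exact: ltW.
- exact: expR_ge1Dx.
- apply: le_trans (wnorm_kick_own _ _ _ _ _ (ltW e0) (rl0 n)) _.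
  rewrite ler_wpM2r//; apply: ler1D_expR_powR => //.
  by rewrite mulr_ge0 ?rl0// ltW.
Qed.

Lemma sqnorm_step alpha n : 1 <= alpha ->
  sqnorm (x n.+1) (y n.+1) <=
  expR (4 * alpha * (r * l n.+1) `^ (1 / alpha)) * sqnorm (x n) (y n).
Proof.
move=> a1; have [-> ->] := xyS n.
apply: le_trans (sqnorm_kick _ _ _ _ (rl0 n)) _.
apply: ler_wpM2r; first by rewrite !addr_ge0 ?sqr_ge0.
have -> : expR (4 * alpha * (r * l n.+1) `^ (1 / alpha)) =
    expR (2 * alpha * (r * l n.+1) `^ (1 / alpha)) ^+ 2.
  by rewrite -expRM_natl; congr expR; ring.
rewrite ler_sqr ?nnegrE ?expR_ge0 ?addr_ge0 ?rl0//.
exact: ler1D_expR_powR.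
Qed.

(** The growth after the node of index [n0], with a free weight [b]. *)
Lemma wnorm_tail (psi b T S : R) n0 : 1 <= b ->
  (forall n, \sum_(n0.+1 <= j < n) l j <= T) ->
  (forall n, \sum_(n0.+1 <= j < n) l j * sin (phi j - psi) ^+ 2 <= S) ->
  forall n, (n0 <= n)%N ->
  norm1 (x n) (y n) <=
    4 * b * expR (2 * r * (b * S + T / b)) * norm1 (x n0) (y n0).
Proof.
move=> b1 lT lS n n0n; have b0 : 0 < b by exact: lt_le_trans b1.
pose f j := 2 * r * (b * (l j * sin (phi j - psi) ^+ 2) + l j / b).
have W0 m : 0 <= wnorm b 1 psi (x m) (y m) by rewrite wnorm_ge0// ltW.
have step m : (n0 <= m)%N -> wnorm b 1 psi (x m.+1) (y m.+1) <=
    expR (f m.+1) * wnorm b 1 psi (x m) (y m).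
  move=> _; have [-> ->] := xyS m.
  apply: le_trans (wnorm_kick _ _ _ _ _ _ b1 (rl0 m)) _.
  rewrite ler_wpM2r//; apply: le_trans (expR_ge1Dx _).
  by rewrite lerD2l /f le_eqVlt; apply/orP; left; apply/eqP; ring.
have h := exp_growth (fun m => wnorm b 1 psi (x m) (y m)) f n0 step n n0n.
have hf : \sum_(n0.+1 <= j < n.+1) f j <= 2 * r * (b * S + T / b).
  rewrite /f -mulr_sumr big_split/= -mulr_sumr -mulr_suml.
  rewrite ler_wpM2l ?mulr_ge0 ?(ltW r0)//; apply: lerD.
    by rewrite ler_wpM2l// ltW.
  by rewrite ler_wpM2r// invr_ge0 ltW.
have h1 : norm1 (x n) (y n) <= 2 * wnorm b 1 psi (x n) (y n).
  apply: le_trans (norm1_le_comp_size psi _ _) _; rewrite ler_wpM2l// /wnorm mul1r.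
  by rewrite lerD2r ler_peMl ?comp_size_ge0.
have h2 : wnorm b 1 psi (x n0) (y n0) <= 2 * b * norm1 (x n0) (y n0).
  have p1 := comp_size_le_norm1 psi (x n0) (y n0).
  have p2 := comp_size_le_norm1 (psi + pi / 2) (x n0) (y n0).
  have p3 : 1 * norm1 (x n0) (y n0) <= b * norm1 (x n0) (y n0).
    by rewrite ler_wpM2r// (le_trans _ p1)// comp_size_ge0.
  have := ler_wpM2l (ltW b0) p1; rewrite /wnorm; lra.
have h3 : wnorm b 1 psi (x n) (y n) <= expR (2 * r * (b * S + T / b)) *
    (2 * b * norm1 (x n0) (y n0)).
  apply: le_trans h _; apply: ler_pM => //.
  by rewrite ler_expR.
lra.
Qed.

Context (alpha beta A B : R) (a1 : 1 <= alpha) (b01 : 0 < beta < 1)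
  (lA : forall n, \sum_(1 <= j < n) l j `^ (1 / alpha) <= A)
  (sB : forall n,
     \sum_(1 <= j < n) `|sin (phi j.+1 - phi j)| `^ (1 / beta) <= B)
  (x0 : x 0%N = (0, 1)) (y0 : y 0%N = (0, 0)).

Let a0 : 0 < alpha. Proof. exact: lt_le_trans a1. Qed.

Let A0 : 0 <= A. Proof. by have := lA 0; rewrite big_geq. Qed.
Let B0 : 0 <= B. Proof. by have := sB 0; rewrite big_geq. Qed.

Let sum_powR (c : R) n : 0 <= c ->
  \sum_(1 <= j < n.+1) (c * l j) `^ (1 / alpha) <= c `^ (1 / alpha) * A.
Proof.
move=> c0; apply: le_trans (ler_wpM2l (powR_ge0 _ _) (lA n.+1)).
rewrite mulr_sumr; apply: ler_sum_nat => j /andP[j1 _].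
by rewrite powRM// ltW// l0.
Qed.

(** The growth over the first [n] intervals. *)
Lemma norm1_head n : (1 <= n)%N ->
  norm1 (x n) (y n) <=
    5 * expR ((4 * alpha * A + 2 + B) * rate alpha beta r n).
Proof.
move=> n1; have n0 : 0 < n%:R :> R by rewrite ltr0n.
have [b0 b1] := andP b01.
have ln_r : 0 <= ln r by exact: ln_ge0.
have ln_n : 0 <= ln n%:R :> R by rewrite ln_ge0// ler1n.
have rE := rateE alpha beta r n r0 n1.
have G0 : 0 < rate alpha beta r n by rewrite rE expR_gt0.
(* [expR k] is the weight that equates the two contributions *)
pose k := (alpha * (1 - beta) * ln n%:R - ln r) / (alpha + 1).
have [k0|/ltW k0] := leP k 0.
- pose e := expR k.
  have e0 : 0 < e by exact: expR_gt0.
  have e1 : e <= 1 by rewrite expR_le1.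
  have eG1 : (e * r) `^ (1 / alpha) = rate alpha beta r n.
    rewrite powR_expR ?mulr_gt0// lnM ?posrE// expRK rE; congr expR.
    by rewrite /k; field; rewrite !gt_eqF// ltr_wpDl// ltW.
  have eG2 : n%:R `^ (1 - beta) / e = rate alpha beta r n.
    rewrite powR_expR// -expRN -expRD rE; congr expR.
    by rewrite /k; field; rewrite gt_eqF// ltr_wpDl// ltW.
  have eG3 : e^-1 <= rate alpha beta r n.
    rewrite -expRN rE ler_expR -mulNr ler_pM2r ?invr_gt0 ?addr_gt0// opprB.
    have h1 : 0 <= (1 - beta) * ln n%:R by rewrite mulr_ge0// subr_ge0 ltW.
    have := mulr_ge0 (ltW a0) h1; lra.
  pose f j := 2 * alpha * (e * (r * l j)) `^ (1 / alpha) +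
      `|sin (phi j.+1 - phi j)| / e.
  have := exp_growth (fun m => wnorm 1 e (phi m.+1) (x m) (y m)) f 0
    (fun m _ => wnorm_frames_step e alpha m e0 e1 a1) n (leq0n n).
  set E := expR _ => h.
  have fG : \sum_(1 <= j < n.+1) f j <=
      (4 * alpha * A + 1 + B) * rate alpha beta r n.
    rewrite /f big_split/= -mulr_sumr -mulr_suml.
    have s1 := sum_le_powR beta (fun j => `|sin (phi j.+1 - phi j)|) B n
      b01 n1 (fun j => normr_ge0 _) (sB n.+1).
    have := ler_wpM2r (_ : 0 <= e^-1) s1; rewrite invr_ge0 ltW// => /(_ isT).
    rewrite mulrAC eG2 => {}s1.
    have := sum_powR (e * r) n (ltW (mulr_gt0 e0 r0)); rewrite eG1.
    under eq_bigr do rewrite -mulrA.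
    move=> /(ler_wpM2l (_ : 0 <= 2 * alpha)); rewrite mulr_ge0 ?(ltW a0)// => /(_ isT).
    have : 0 <= alpha * (rate alpha beta r n * A) by rewrite !mulr_ge0// ltW.
    lra.
  have h0 : wnorm 1 e (phi 1%N) (x 0%N) (y 0%N) <= 2.
    have p01 a : proj a (0, 1) = sin a by rewrite /proj/= mulr0 add0r mulr1.
    have p00 a : proj a (0, 0) = 0 by rewrite /proj/= !mulr0 addr0.
    rewrite x0 y0 /wnorm /comp_size !p01 !p00 normr0 !addr0 sinDpihalf mul1r.
    apply: (@le_trans _ _ (1 + 1)) => //; apply: lerD; first exact: sin_max.
    apply: le_trans e1; rewrite ger_pMr//; exact: cos_max.
  have h1 : norm1 (x n) (y n) <= 2 * (e^-1 * wnorm 1 e (phi n.+1) (x n) (y n)).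
    apply: le_trans (norm1_le_comp_size (phi n.+1) _ _) _; rewrite ler_wpM2l//.
    rewrite /wnorm mul1r mulrDr; apply: lerD; last by rewrite mulKf ?gt_eqF.
    by rewrite ler_peMl ?comp_size_ge0// invf_ge1.
  have h2 : E <= expR ((4 * alpha * A + 1 + B) * rate alpha beta r n).
    by rewrite ler_expR.
  have -> : (4 * alpha * A + 2 + B) * rate alpha beta r n =
      rate alpha beta r n + (4 * alpha * A + 1 + B) * rate alpha beta r n by ring.
  rewrite expRD; apply: le_trans h1 _.
  have h3 : wnorm 1 e (phi n.+1) (x n) (y n) <=
      expR ((4 * alpha * A + 1 + B) * rate alpha beta r n) * 2.
    apply: le_trans h _; apply: ler_pM => //; first exact: expR_ge0.
    by apply: wnorm_ge0 => //; exact: ltW.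
  have h4 : e^-1 <= expR (rate alpha beta r n).
    by apply: le_trans eG3 _; apply: le_trans (expR_ge1Dx _); rewrite lerDr.
  have := ler_pM (_ : 0 <= e^-1) (wnorm_ge0 1 e (phi n.+1) (x n) (y n) ler01 (ltW e0)) h4 h3.
  rewrite invr_ge0 ltW// => /(_ isT).
  set E1 := expR _; set E2 := expR _.
  have : 0 <= E1 * E2 by rewrite mulr_ge0 ?expR_ge0.
  lra.
- (* rotations preserve the Euclidean norm, so only the lengths count *)
  have rG : r `^ (1 / alpha) <= rate alpha beta r n.
    rewrite powR_expR// rE ler_expR mulrC mul1r mulrC.
    have d0 : 0 < alpha + 1 by rewrite ltr_wpDl// ltW.
    have : 0 <= k / alpha by rewrite divr_ge0// ltW.
    have -> : k / alpha = (ln r + (1 - beta) * ln n%:R) / (alpha + 1) - alpha^-1 * ln r.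
      by rewrite /k; field; rewrite !gt_eqF.
    by rewrite subr_ge0.
  pose f j := 4 * alpha * (r * l j) `^ (1 / alpha).
  have := exp_growth (fun m => sqnorm (x m) (y m)) f 0
    (fun m _ => sqnorm_step alpha m a1) n (leq0n n).
  have fG : \sum_(1 <= j < n.+1) f j <= 4 * alpha * A * rate alpha beta r n.
    rewrite /f -mulr_sumr -[leRHS]mulrA ler_wpM2l ?mulr_ge0 ?(ltW a0)//.
    apply: le_trans (sum_powR r n (ltW r0)) _.
    by rewrite mulrC ler_wpM2l.
  have -> : sqnorm (x 0%N) (y 0%N) = 1.
    by rewrite x0 y0 /sqnorm/= !expr0n/= expr1n !addr0 add0r.
  rewrite mulr1 => h; apply: le_trans (norm1_le_sqnorm _ _) _.
  set E := expR (_ * rate _ _ _ _).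
  have hE : expR (\sum_(1 <= j < n.+1) f j) <= E.
    rewrite ler_expR; apply: le_trans fG _; rewrite ler_wpM2r ?(ltW G0)//.
    have := B0; lra.
  have E1 : 1 <= E.
    rewrite -[leLHS]expR0 ler_expR mulr_ge0 ?(ltW G0)//.
    by rewrite !addr_ge0// !mulr_ge0// ltW.
  lra.
Qed.

End growth_bounds.

(** * The growth function *)

Section growth_function.
Context {R : realType}.
Implicit Types (a r t : R) (l phi : nat -> R) (N : nat).

Lemma abs_sinD_int a (m : int) : `|sin (a + pi * m%:~R)| = `|sin a|.
Proof.
have nat_case (b : R) (n : nat) : `|sin (b + pi * n%:R)| = `|sin b|.
  elim: n b => [|n IH] b; first by rewrite mulr0 addr0.
  by rewrite -natr1 mulrDr mulr1 addrA sinDpi normrN IH.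
case: m => n; first exact: nat_case.
by rewrite NegzE mulrNz mulrN -(nat_case (a - _) n.+1) subrK.
Qed.

Lemma sin_eq0_pi a : sin a = 0 -> exists m : int, a = pi * m%:~R.
Proof.
move=> sa0; pose m := Num.floor (a / pi); exists m.
have p0 : 0 < pi :> R by exact: pi_gt0.
have h1 : m%:~R * pi <= a by rewrite -ler_pdivlMr// floor_le.
have h2 : a < (m%:~R + 1) * pi.
  by rewrite -ltr_pdivrMr// -intrD1 floorD1_gt.
apply/eqP; rewrite -subr_eq0; apply/eqP.
have := abs_sinD_int (a - pi * m%:~R) m; rewrite subrK sa0 normr0 => /esym/normr0_eq0 s0.
apply/eqP; apply: contraT => N0.
have : 0 < sin (a - pi * m%:~R).
  by apply: sin_gt0_pi; rewrite lt_neqAle eq_sym N0/=; apply/andP; split; lra.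
by rewrite s0 ltxx.
Qed.

(** Two consecutive angles are never both congruent to [psi] modulo [pi]. *)
Lemma tail_sum_sin_gt0 l phi psi N :
  (forall j, (1 <= j)%N -> 0 < l j) ->
  (\sum_(1 <= j <oo) (l j * sin (phi j - psi) ^+ 2)%:E < +oo)%E ->
  (forall j, (1 <= j)%N -> forall m : int, phi j.+1 - phi j != pi * m%:~R) ->
  0 < tail_sum (fun j => l j * sin (phi j - psi) ^+ 2) N.
Proof.
move=> l0 ss phiN; set u := fun j => _.
have u0 j : (1 <= j)%N -> 0 <= u j by move=> j1; rewrite mulr_ge0 ?sqr_ge0 ?ltW ?l0.
have uN j : (1 <= j)%N -> u j = 0 -> sin (phi j - psi) = 0.
  by move=> j1 /eqP; rewrite mulf_eq0 gt_eqF ?l0//= sqrf_eq0 => /eqP.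
have := tail_sum_ge0 _ u0 ss N; rewrite le_eqVlt => /predU1P[/esym t0|//].
have := tail_sum_ge0 _ u0 ss N.+2.
have := u0 N.+1 isT; have := u0 N.+2 isT.
have := tail_sumS _ u0 ss N; have := tail_sumS _ u0 ss N.+1 => e1 e2 p1 p2 p3.
have z1 : u N.+1 = 0 by lra.
have [m1 E1] := sin_eq0_pi _ (uN N.+1 isT z1).
have z2 : u N.+2 = 0 by lra.
have [m2 E2] := sin_eq0_pi _ (uN N.+2 isT z2).
have /eqP[] := phiN N.+1 isT (m2 - m1).
rewrite intrB mulrBr -E1 -E2; ring.
Qed.

Lemma Fminus_spec (F : nat -> R) r : F 1%N < r ->
  (exists M, forall N, F N < r -> (N <= M)%N) ->
  (1 <= Fminus F r)%N /\ r <= F (Fminus F r).+1.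
Proof.
move=> F1 [M HM]; rewrite /Fminus; set A := [set N | _].
have eA : exists N, `[< A N >] by exists 1%N; apply/asboolP.
have bA N : `[< A N >] -> (N <= M)%N by move=> /asboolP[_ /HM].
case: (ex_maxnP eA bA) => N /asboolP AN maxN.
have [|[x1 Fx] ubx] := @xgetPex _ 0%N (A `&` ubound A).
  exists N; split=> // n An; rewrite leEnat; apply: maxN; exact/asboolP.
set x := xget _ _ in x1 Fx ubx *; split=> //.
rewrite leNgt; apply/negP => FS; have := ubx x.+1 (conj isT FS).
by rewrite leEnat ltnn.
Qed.

(** [growthF] is at least a positive multiple of a positive power of [N]. *)
Lemma growthF_bounded l phi alpha beta psi r :
  0 < alpha -> 0 < beta < 1 ->
  let P N := tail_sum l N * tail_sum (fun j => l j * sin (phi j - psi) ^+ 2) N in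
  (forall N, 0 < P N) -> (forall N, P N <= P 0%N) ->
  exists M, forall N, growthF l phi alpha beta psi N < r -> (N <= M)%N.
Proof.
move=> a0 /andP[b0 b1] P P0 Ple.
pose c := (alpha + 1) / (2 * alpha).
have c0 : 0 < c by rewrite divr_gt0 ?mulr_gt0// addr_gt0.
pose g := (1 - beta) / alpha.
have g0 : 0 < g by rewrite divr_gt0// subr_gt0.
pose K := P 0%N `^ (- c).
have K0 : 0 < K by rewrite powR_gt0.
have le1 N : K * N%:R `^ g <= growthF l phi alpha beta psi N.
  rewrite /growthF -/(P N) mulrC ler_wpM2l ?powR_ge0//.
  rewrite /K !powRN lef_pV2 ?posrE ?powR_gt0//.
  by apply: (ge0_ler_powR _ _ _ (Ple N)); rewrite ?nnegrE ltW.
pose B := `|r / K| `^ g^-1.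
exists (Num.trunc B).+1 => N FN; rewrite leqNgt; apply/negP => MN.
have BN : B <= N%:R.
  by apply: ltW; apply: lt_trans (truncnS_gt _) _; rewrite ltr_nat.
have : B `^ g <= N%:R `^ g.
  by apply: (ge0_ler_powR _ _ _ BN); rewrite ?nnegrE ?powR_ge0// ltW.
rewrite /B -powRrM mulVf ?gt_eqF// powRr1// => h.
have := le_lt_trans (le1 N) FN; rewrite mulrC -ltr_pdivlMr// ltNge.
by rewrite (le_trans (ler_norm _) h).
Qed.

(** [r <= F n] solved for the product of the two tails. *)
Lemma le_growthF l phi alpha beta psi r n :
  0 < alpha -> 0 < r -> (1 <= n)%N ->
  let P := tail_sum l n * tail_sum (fun j => l j * sin (phi j - psi) ^+ 2) n in
  0 < P -> r <= growthF l phi alpha beta psi n ->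
  P <= (rate alpha beta r n / r) ^+ 2.
Proof.
move=> a0 r0 n1 P P0; rewrite /growthF -/P.
have n0 : 0 < n%:R :> R by rewrite ltr0n.
have d0 : 0 < alpha + 1 by rewrite addr_gt0.
rewrite [_ `^ ((1 - beta) / alpha)]powR_expR// [P `^ _]powR_expR// -expRD.
rewrite -{1}[r](@lnK R) ?posrE// ler_expR => h.
rewrite rateE// -{2}[r](@lnK R) ?posrE// -expRB -expRM_natl -{1}[P](@lnK R) ?posrE//.
rewrite ler_expR.
have k0 : 0 <= 2 * alpha / (alpha + 1) by rewrite divr_ge0 ?mulr_ge0// ltW.
have := ler_wpM2l k0 h.
have -> : 2 * alpha / (alpha + 1) * ((1 - beta) / alpha * ln n%:R +
    - ((alpha + 1) / (2 * alpha)) * ln P) =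
    2 * (1 - beta) * ln n%:R / (alpha + 1) - ln P.
  by field; rewrite !gt_eqF.
have -> : 2 * ((ln r + (1 - beta) * ln n%:R) / (alpha + 1) - ln r) =
   2 * (1 - beta) * ln n%:R / (alpha + 1) - 2 * alpha / (alpha + 1) * ln r.
  by field; rewrite gt_eqF.
lra.
Qed.

(** This holds because [n + 1 <= 2 n] and both exponents are at most [1]. *)
Lemma rateS alpha beta r n : 0 < alpha -> 0 < beta < 1 -> 0 <= r -> (1 <= n)%N ->
  rate alpha beta r n.+1 <= 2 * rate alpha beta r n.
Proof.
move=> a0 /andP[b0 b1] r0 n1.
have n0 : 0 <= n%:R :> R by [].
have d0 : 0 < alpha + 1 by rewrite addr_gt0.
have h t s : 0 <= t -> 0 < s -> s <= 1 -> (2 * t) `^ s <= 2 * t `^ s.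
  move=> t0 s0 s1; rewrite powRM// ler_wpM2r ?powR_ge0//.
  by apply: ler1_powR => //; rewrite ler1n.
have e0 : 0 < 1 / (alpha + 1) by rewrite divr_gt0.
have e1 : 1 / (alpha + 1) <= 1 by rewrite ler_pdivrMr// mul1r lerDr ltW.
apply: le_trans (h _ _ _ e0 e1); last by rewrite mulr_ge0 ?powR_ge0.
apply: ge0_ler_powR; rewrite ?nnegrE ?(ltW e0) ?mulr_ge0 ?powR_ge0//.
rewrite mulrCA ler_wpM2l//.
apply: le_trans (h _ _ n0 _ _); rewrite ?subr_gt0 ?lerBlDr ?lerDl ?(ltW b0)//.
apply: ge0_ler_powR; rewrite ?nnegrE ?mulr_ge0 ?subr_ge0 ?(ltW b1)//.
by rewrite -natrM ler_nat mul2n -addnn -addn1 leq_add2l.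
Qed.

End growth_function.

(** * The bound on the monodromy matrix *)

Lemma sin_weight_summable {R : realType} (l phi : nat -> R) psi :
  (forall j, (1 <= j)%N -> 0 <= l j) ->
  (\sum_(1 <= j <oo) (l j)%:E < +oo)%E ->
  let u j := l j * sin (phi j - psi) ^+ 2 in
  [/\ forall j, (1 <= j)%N -> 0 <= u j,
      (\sum_(1 <= j <oo) (u j)%:E < +oo)%E
    & forall N, tail_sum u N <= tail_sum l N].
Proof.
move=> l0 ls u.
have u0 j : (1 <= j)%N -> 0 <= u j by move=> j1; rewrite mulr_ge0 ?sqr_ge0 ?l0.
have ul j : (1 <= j)%N -> u j <= l j.
  by move=> j1; rewrite /u ler_piMr ?l0// sin2cos2 lerBlDr lerDl sqr_ge0.
have us : (\sum_(1 <= j <oo) (u j)%:E < +oo)%E.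
  apply: le_lt_trans ls; rewrite eseries_cond [leRHS]eseries_cond.
  apply: lee_nneseries => j.
    by move=> _ /andP[_ j1]; rewrite lee_fin u0.
  by move=> /andP[_ j1]; rewrite lee_fin ul.
split=> // N; have cu := cvg_tail_sum _ u0 us N.
rewrite -(cvg_lim (@Rhausdorff R) cu); apply: limr_le.
  by apply/cvg_ex; eexists; exact: cu.
apply: nearW => n; apply: le_trans (sum_nat_le_tail_sum _ l0 ls N n).
by apply: ler_sum_nat => j /andP[Nj _]; apply: ul; exact: leq_trans Nj.
Qed.

(** [norm1_head] and [wnorm_tail] combined at the index [n]. *)
Lemma norm1_le_rate {R : realType} (l phi : nat -> R) (alpha beta psi A B r : R)
    (x y : nat -> R * R) n :
  (forall j, (1 <= j)%N -> 0 < l j) ->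
  (\sum_(1 <= j <oo) (l j)%:E < +oo)%E ->
  (forall j, (1 <= j)%N -> forall m : int, phi j.+1 - phi j != pi * m%:~R) ->
  1 <= alpha -> 0 < beta < 1 -> 1 <= r -> (1 <= n)%N ->
  (forall n, \sum_(1 <= j < n) l j `^ (1 / alpha) <= A) ->
  (forall n, \sum_(1 <= j < n) `|sin (phi j.+1 - phi j)| `^ (1 / beta) <= B) ->
  x 0%N = (0, 1) -> y 0%N = (0, 0) ->
  (forall n,
     x n.+1 = kick (r * l n.+1) (phi n.+1) (y n) (x n) /\
     y n.+1 = kick (- (r * l n.+1)) (phi n.+1) (x n) (y n)) ->
  r <= growthF l phi alpha beta psi n ->
  forall N, (n <= N)%N -> norm1 (x N) (y N) <=
    expR ((27 + total_length l + alpha + 4 * alpha * A + B) * rate alpha beta r n).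
Proof.
move=> l0 ls phiN a1 b01 r1 n1 lA sB x0 y0 xyS rF N nN.
have a0 : 0 < alpha by exact: lt_le_trans a1.
have r0 : 0 < r by exact: lt_le_trans r1.
have [b0 b1] := andP b01.
have l0' j : (1 <= j)%N -> 0 <= l j by move=> /l0/ltW.
have [u0 us ul] := sin_weight_summable l phi psi l0' ls.
set u := fun j => l j * _ in u0 us ul.
pose T := tail_sum l n; pose S := tail_sum u n.
have S0 : 0 < S by exact: tail_sum_sin_gt0.
have ST : S <= T by exact: ul.
have T0 : 0 < T by exact: lt_le_trans ST.
have TL : T <= total_length l by exact: tail_sum_noninc.
set G := rate alpha beta r n.
have d0 : 0 < alpha + 1 by rewrite addr_gt0.
have lnr0 : 0 <= ln r by exact: ln_ge0.
have lnn0 : 0 <= ln n%:R :> R by rewrite ln_ge0// ler1n.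
have kn : 0 <= (1 - beta) * ln n%:R by rewrite mulr_ge0// subr_ge0 ltW.
have G1 : 1 <= G.
  by rewrite /G rateE// -[leLHS]expR0 ler_expR divr_ge0// ?addr_ge0// ltW.
have G0 : 0 < G by exact: lt_le_trans G1.
have rG : r <= expR ((alpha + 1) * G).
  rewrite -[leLHS]lnK ?posrE// ler_expR mulrC -ler_pdivrMr//.
  apply: le_trans (_ : (ln r + (1 - beta) * ln n%:R) / (alpha + 1) <= G).
    by rewrite ler_pM2r ?invr_gt0// lerDl.
  by rewrite /G rateE//; apply: le_trans (expR_ge1Dx _); rewrite lerDr.
pose q := G / r.
have q0 : 0 < q by rewrite divr_gt0.
have TSq : T * S <= q ^+ 2 by apply: le_growthF => //; rewrite mulr_gt0.
(* balances the two contributions of the tail to at most [q] each *)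
pose b := Num.max 1 (T / q).
have b1' : 1 <= b by rewrite le_max lexx.
have bp : 0 < b by exact: lt_le_trans b1'.
have Tb : T / b <= q by rewrite ler_pdivrMr// -ler_pdivrMl// mulrC le_max lexx orbT.
have bS : b * S <= q.
  rewrite /b; case: (leP 1 (T / q)) => [_|].
    by rewrite mulrAC ler_pdivrMr.
  by rewrite ltr_pdivrMr// !mul1r => /ltW; exact: le_trans.
have bE : b <= expR ((total_length l + alpha + 1) * G).
  have L0 : 0 <= total_length l by exact: le_trans (ltW T0) TL.
  rewrite ge_max; apply/andP; split.
    by rewrite -[leLHS]expR0 ler_expR mulr_ge0 ?(ltW G0)// !addr_ge0// ltW.
  have -> : (total_length l + alpha + 1) * G = total_length l * G + (alpha + 1) * G.
    by ring.
  rewrite expRD; have -> : T / q = (T / G) * r by rewrite /q; field; rewrite !gt_eqF.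
  apply: ler_pM => //; first by rewrite divr_ge0// ltW.
    exact: ltW.
  apply: le_trans (expR_ge1Dx _); apply: le_trans (_ : T / G <= T) _.
    by rewrite ler_pdivrMr// ler_peMr// ltW.
  have : total_length l <= total_length l * G by rewrite ler_peMr.
  lra.
have head := norm1_head l phi r x y l0 r1 xyS alpha beta A B a1 b01 lA sB x0 y0 n n1.
have tail := wnorm_tail l phi r x y l0 r1 xyS psi b T S n b1'
  (sum_nat_le_tail_sum _ l0' ls n) (sum_nat_le_tail_sum _ u0 us n) N nN.
apply: le_trans tail _.
have e4 : expR (2 * r * (b * S + T / b)) <= expR (4 * G).
  rewrite ler_expR -mulrA.
  have := ler_wpM2l (ltW r0) (lerD bS Tb).
  have -> : r * (q + q) = 2 * G by rewrite /q; field; rewrite gt_eqF.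
  lra.
have e20 : 20 <= expR (20 * G).
  apply: le_trans (expR_ge1Dx _); have := G1; lra.
have -> : (27 + total_length l + alpha + 4 * alpha * A + B) * G =
   20 * G + (total_length l + alpha + 1) * G + 4 * G + (4 * alpha * A + 2 + B) * G.
  by ring.
rewrite !expRD.
have h1 := ler_pM (ltW bp) (expR_ge0 _) bE e4.
have n0 : 0 <= norm1 (x n) (y n) by rewrite !addr_ge0.
have h2 := ler_pM (mulr_ge0 (ltW bp) (expR_ge0 _)) n0 h1 head.
have h3 := ler_wpM2r (mulr_ge0 (mulr_ge0 (expR_ge0 ((total_length l + alpha + 1) * G))
  (expR_ge0 (4 * G))) (expR_ge0 ((4 * alpha * A + 2 + B) * G))) e20.
move: h2 h3; rewrite -/G; lra.
Qed.

Theorem theorem4p9 (R : realType) (l phi : nat -> R) (H : R -> 'M[R]_2)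
    (W : R -> R[i] -> 'M[R[i]]_2) (alpha beta psi : R)
    (hH : limit_circle_Hamburger l phi H)
    (hW : forall z : R[i],
      fundamental_solution H (total_length l) z (fun t => W t z))
    (halpha : 1 <= alpha) (hbeta : 0 < beta < 1)
    (hl : in_ell (1 / alpha) l)
    (hphi : in_ell (1 / beta) (fun j => `|sin (phi j.+1 - phi j)|)) :
  exists2 C : R, 0 < C &
    \forall r \near +oo,
      ln (ComplexField.Normc.normc
            (W (total_length l) (0 +i* r)%C ord_max ord_max)) <=
      C * (r * (Fminus (growthF l phi alpha beta psi) r)%:R `^ (1 - beta))
            `^ (1 / (alpha + 1)).
Proof.
have [l0 ls phiN _] := hH; have [b0 b1] := andP hbeta.
have a0 : 0 < alpha by exact: lt_le_trans halpha.
have l0' j : (1 <= j)%N -> 0 <= l j by move=> /l0/ltW.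
pose A := fine (\sum_(1 <= j <oo) (`|l j| `^ (1 / alpha))%:E)%E.
pose B := fine (\sum_(1 <= j <oo)
  (`| `|sin (phi j.+1 - phi j)| | `^ (1 / beta))%:E)%E.
have lA n : \sum_(1 <= j < n) l j `^ (1 / alpha) <= A.
  have := sum_nat_le_eseries _ (fun j _ => powR_ge0 _ _) hl 1 n isT.
  apply: le_trans; apply: ler_sum_nat => j /andP[j1 _].
  by rewrite ger0_norm// l0'.
have sB n : \sum_(1 <= j < n) `|sin (phi j.+1 - phi j)| `^ (1 / beta) <= B.
  have := sum_nat_le_eseries _ (fun j _ => powR_ge0 _ _) hphi 1 n isT.
  by apply: le_trans; apply: ler_sum_nat => j _; rewrite normr_id.
have A0 : 0 <= A by have := lA 0%N; rewrite big_geq.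
have B0 : 0 <= B by have := sB 0%N; rewrite big_geq.
have L0 : 0 <= total_length l by exact: tail_sum_ge0.
pose K := 27 + total_length l + alpha + 4 * alpha * A + B.
have K0 : 0 < K.
  have : 0 <= 4 * alpha * A by rewrite !mulr_ge0// ltW.
  by rewrite /K; lra.
have [u0 us ul] := sin_weight_summable l phi psi l0' ls.
set u := fun j => l j * _ in u0 us ul.
have P0 N : 0 < tail_sum l N * tail_sum u N.
  have S0 := tail_sum_sin_gt0 l phi psi N l0 us phiN.
  by rewrite mulr_gt0// (lt_le_trans S0).
have Pnoninc N : tail_sum l N * tail_sum u N <= tail_sum l 0 * tail_sum u 0.
  by apply: ler_pM; rewrite ?tail_sum_ge0 ?tail_sum_noninc.
exists (2 * K); first by rewrite mulr_gt0.
near=> r.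
have r1 : 1 <= r by near: r; apply: nbhs_pinfty_ge; exact: num_real.
have F1r : growthF l phi alpha beta psi 1 < r.
  by near: r; apply: nbhs_pinfty_gt; exact: num_real.
have [N1 rF] := Fminus_spec _ _ F1r
  (growthF_bounded l phi alpha beta psi r a0 hbeta P0 Pnoninc).
set N := Fminus _ r in N1 rF *; rewrite -/(rate alpha beta r N).
have [Re0 Im0] := row2_start _ _ _ _ (hW (0 +i* r)%C).
have node0 : node l 0 = 0 by rewrite /node big_geq.
have bound n : (N.+1 <= n)%N ->
    `|(rowRe (fun t => W t (0 +i* r)%C) (node l n)).2| +
    `|(rowIm (fun t => W t (0 +i* r)%C) (node l n)).2| <=
    expR (K * rate alpha beta r N.+1).
  move=> Nn; have := norm1_le_rate l phi alpha beta psi A B r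
    (fun n => rowRe (fun t => W t (0 +i* r)%C) (node l n))
    (fun n => rowIm (fun t => W t (0 +i* r)%C) (node l n)) N.+1
    l0 ls phiN halpha hbeta r1 isT lA sB.
  rewrite node0 => /(_ Re0 Im0 (row2_recursion _ _ _ _ _ hH (hW _)) rF n Nn).
  by apply: le_trans; rewrite /norm1; apply: lerD; rewrite lerDr.
have := monodromy22_le l phi H (fun t => W t (0 +i* r)%C) _ N.+1 _ hH (hW _) bound.
set w := ComplexField.Normc.normc _ => wK.
have r0 : 0 <= r by exact: le_trans r1.
have lnw : ln w <= K * rate alpha beta r N.+1.
  have [w0|w0] := ltP 0 w; first by rewrite -ler_expR lnK.
  by rewrite ln0// mulr_ge0 ?powR_ge0// ltW.
apply: le_trans lnw _.
apply: le_trans (ler_wpM2l (ltW K0) (rateS alpha beta r N a0 hbeta r0 N1)) _.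
by rewrite mulrA [K * 2]mulrC.
Unshelve. all: by end_near. Qed.
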